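(* The generalized topological space $\langle\mathbb{R},\mathcal{T}^+\rangle$ is normal; that is, for any disjoint $\mathcal{T}^+$-closed sets $A,B\subset\mathbb{R}$ there exist $C,D\in\mathcal{T}^+$ such that $A\subset C$, $B\subset D$ and $C\cap D=\emptyset$.
   Context: $\mathcal{L}$ is the family of Lebesgue measurable subsets of $\mathbb{R}$, $\lambda$ is Lebesgue measure. For $A\in\mathcal{L}$ and $x\in\mathbb{R}$ put $\bar D(A,x)=\limsup_{h\to0^+}\frac{\lambda(A\cap[x-h,x+h])}{2h}$, $\Phi^+(A)=\{x\in\mathbb{R}:\bar D(A,x)>0\}$, and $\mathcal{T}^+=\{A\in\mathcal{L}:A\subset\Phi^+(A)\}$. The family $\mathcal{T}^+$ contains $\emptyset$ and $\mathbb{R}$ and is closed under arbitrary unions (a strong generalized topology). A set is $\mathcal{T}^+$-closed if its complement in $\mathbb{R}$ belongs to $\mathcal{T}^+$. *)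

(* Defs.v *)
From HB Require Import structures.
From mathcomp Require Import all_boot all_order all_algebra.
From mathcomp Require Import all_classical all_reals all_analysis.
Set Implicit Arguments.
Unset Strict Implicit.
Unset Printing Implicit Defensive.
Import Order.TTheory GRing.Theory Num.Theory.
Import numFieldNormedType.Exports.
Local Open Scope classical_set_scope.
Local Open Scope ring_scope.

(* The Lebesgue sigma-algebra: this is the domain on which
   [completed_lebesgue_measure] is a measure, namely the sets that are
   Caratheodory measurable for Lebesgue outer measure.  The default
   sigma-algebra carried by [R] is only the Borel one. *)
Definition lebesgue_measurable (R : realType) : set (set R) :=
  ((@wlength R idfun)^*)%mu.-cara.-measurable.

(* Off [lebesgue_measurable R], [completed_lebesgue_measure] is Lebesgue
   outer measure. *)
Definition upper_density (R : realType) (A : set R) (x : R) : \bar R :=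
  limf_esup
    (fun h : R =>
       completed_lebesgue_measure (A `&` [set` `[x - h, x + h]%R]) / (2 * h)%:E)%E
    0^'+.

Definition Phi_plus (R : realType) (A : set R) : set R :=
  [set x | (0 < upper_density A x)%E].

Definition T_plus (R : realType) : set (set R) :=
  [set A | lebesgue_measurable A /\ A `<=` Phi_plus A].
Arguments T_plus : clear implicits.

(* A generalized topology on [X] is given by its family [T] of open sets. *)
Definition gt_closed (X : Type) (T : set (set X)) (A : set X) : Prop :=
  T (~` A).

Definition gt_normal (X : Type) (T : set (set X)) : Prop :=
  forall A B : set X, gt_closed T A -> gt_closed T B -> A `&` B = set0 ->
  exists C D : set X,
    [/\ T C, T D, A `<=` C, B `<=` D & C `&` D = set0].

(* Main.v *)
Require Import Defs.
From mathcomp Require Import all_boot all_order all_algebra.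
From mathcomp Require Import all_classical all_reals all_analysis.
From mathcomp Require Import measurable_realfun ring lra.
Set Implicit Arguments.
Unset Strict Implicit.
Unset Printing Implicit Defensive.
Import Order.TTheory GRing.Theory Num.Theory.
Import numFieldNormedType.Exports.
Local Open Scope classical_set_scope.
Local Open Scope ring_scope.

(* Let [E] be the complement of [A `|` B].  By the Lebesgue density theorem, the
   points of [A] outside [Phi_plus A] and those of [B] outside [Phi_plus B] form
   a null set [N]; as [A] and [B] are closed, [N `<=` Phi_plus E].  So it is
   enough to find disjoint [S1, S2 `<=` E] such that [N] lies in both
   [Phi_plus S1] and [Phi_plus S2], and then to discard null sets from
   [A `|` S1] and [B `|` S2].
   Take open sets [G 0, G 1, ...], decreasing, containing [N], of measure
   tending to 0, and cover almost all of [E `&` (G j `\` G j.+1)] by countably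
   many balls in which [E] has density at least 1/2 and whose fivefold dilations
   lie in [G j].  Make the resulting cells disjoint and halve each of them in
   measure: [S1] and [S2] collect the halves.  If [E] has upper density more
   than [c] at [x \in N], pick an almost maximal [h] such that [ball x h] lies
   in [G k] and [E] has density at least [c] in it.  A cell of radius [s >= h]
   meeting [ball x h] would make [3 * s] another such radius; hence all cells
   meeting [ball x h] lie in [ball x (3 * h)], where [S1] and [S2] thus both get
   at least half of the measure of [E `&` ball x h]. *)

(** * Outer measure and positive upper density *)

Lemma le_lebesgue_measure (R : realType) (A B : set R) : A `<=` B ->
  (@lebesgue_measure R A <= lebesgue_measure B)%E.
Proof. exact: (le_outer_measure (@lebesgue_measure R)). Qed.

Lemma lebesgue_measureU_le (R : realType) (A B : set R) :
  (@lebesgue_measure R (A `|` B) <= lebesgue_measure A + lebesgue_measure B)%E.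
Proof. exact: (outer_measureU2 (@lebesgue_measure R)). Qed.

Lemma lebesgue_measure_negligible (R : realType) (N : set R) :
  (@lebesgue_measure R).-negligible N -> @lebesgue_measure R N = 0%E.
Proof. by move/negligible_outer_measure. Qed.

(** The interval [[x - h, x + h]] lies between [ball x h] and [ball x (2 * h)], and a factor 2 in
    the radius only affects the constant [c]. *)
Lemma Phi_plusP (R : realType) (A : set R) (x : R) :
  Phi_plus A x <-> exists2 c : R, 0 < c & forall e, 0 < e ->
    exists h, [/\ 0 < h, h < e &
      ((c * h)%:E <= @lebesgue_measure R (A `&` ball x h))%E].
Proof.
rewrite /Phi_plus /= /upper_density limf_esupE; split=> [D0|[c c0 Dc]].
- set L := ereal_inf _ in D0.
  have [c c0 cL] : exists2 c : R, 0 < c & (c%:E < L)%E.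
    case: L D0 => [r||] //; first by rewrite lte_fin => r0; exists (r / 2);
      rewrite ?lte_fin; lra.
    by exists 1 => //; rewrite ltry.
  exists c => // e e0.
  have [h /andP[h0 he] ch] : exists2 h, 0 < h < e / 2 &
      (c%:E < completed_lebesgue_measure (A `&` [set` `[x - h, x + h]%R]) /
        (2 * h)%:E)%E.
    have /ereal_sup_gt[_ [h he <-] ch] : (c%:E < ereal_sup
        [set (completed_lebesgue_measure (A `&` [set` `[x - h, x + h]%R]) /
          (2 * h)%:E)%E | h in [set h | (0 < h < e / 2)%R]])%E.
      apply: (lt_le_trans cL); apply: ge_ereal_inf; eexists; last exact: lexx.
      exists [set h | 0 < h < e / 2] => //.
      near=> h; apply/andP; split; first by near: h; exact: nbhs_right_gt.
      by near: h; apply: nbhs_right_lt; lra.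
    by exists h.
  exists (2 * h); split; [lra|lra|].
  move: ch; rewrite inver mulf_eq0 !gt_eqF//= lte_pdivlMr; last by lra.
  rewrite -EFinM => /ltW/le_trans; apply; apply: le_lebesgue_measure.
  apply: setIS => y /=; rewrite in_itv /= => /andP[? ?].
  by rewrite /ball /= ltr_norml; apply/andP; split; lra.
- apply: (@lt_le_trans _ _ (c / 2)%:E); first by rewrite lte_fin; lra.
  apply: le_ereal_inf_tmp => _ [V V0 <-].
  have [e /= e0 eV] := V0.
  have [h [h0 he ch]] := Dc e e0.
  apply: le_ereal_sup_tmp; eexists.
    by exists h; [apply: eV => //=; rewrite sub0r normrN gtr0_norm|reflexivity].
  rewrite inver mulf_eq0 !gt_eqF//= lee_pdivlMr; last by lra.
  rewrite -EFinM; have -> : c / 2 * (2 * h) = c * h by lra.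
  apply: (le_trans ch); apply: le_lebesgue_measure.
  apply: setIS => y /=; rewrite in_itv /= /ball /= ltr_norml => /andP[? ?].
  by apply/andP; split; lra.
Unshelve. all: by end_near. Qed.

Lemma Phi_plusS (R : realType) (A B : set R) :
  A `<=` B -> Phi_plus A `<=` Phi_plus B.
Proof.
move=> AB x /Phi_plusP[c c0 Ac]; apply/Phi_plusP; exists c => // e e0.
have [h [h0 he ch]] := Ac e e0; exists h; split=> //.
by apply: (le_trans ch); apply: le_lebesgue_measure; exact: setSI.
Qed.

(** If [A] fails with the constant [c / 2], it takes less than half of [c * h] at all small radii,
    so the rest falls to [B]. *)
Lemma Phi_plusU (R : realType) (A B : set R) :
  Phi_plus (A `|` B) `<=` Phi_plus A `|` Phi_plus B.
Proof.
move=> x /Phi_plusP[c c0 ABc].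
have [|nA] := pselect (Phi_plus A x); [by left|right].
have [e1 e10 Ae1] : exists2 e1, 0 < e1 & forall h, 0 < h -> h < e1 ->
    (@lebesgue_measure R (A `&` ball x h) < (c / 2 * h)%:E)%E.
  apply: contrapT => H; apply: nA; apply/Phi_plusP; exists (c / 2); first by lra.
  move=> e e0; apply: contrapT => nh; apply: H; exists e => // h h0 he.
  by rewrite ltNge; apply/negP => ch; apply: nh; exists h.
apply/Phi_plusP; exists (c / 2); first by lra.
move=> e e0; have [|h [h0]] := ABc (Num.min e e1); first by rewrite lt_min e0.
rewrite lt_min => /andP[he he1] ch; exists h; split=> //.
rewrite leNgt; apply/negP => Bh; move: ch; apply/negP; rewrite -ltNge setIUl.
apply: (le_lt_trans (lebesgue_measureU_le _ _)).
have -> : c * h = c / 2 * h + c / 2 * h by lra.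
by rewrite EFinD; apply: lteD => //; exact: Ae1.
Qed.

Lemma Phi_plus_negligible (R : realType) (N : set R) :
  (@lebesgue_measure R).-negligible N -> Phi_plus N = set0.
Proof.
move=> N0; rewrite -subset0 => x /Phi_plusP[c c0 /(_ 1 ltr01)[h [h0 _]]].
rewrite lebesgue_measure_negligible; last exact: negligibleS N0.
by rewrite lee_fin leNgt mulr_gt0.
Qed.

Lemma Phi_plusU_negligible (R : realType) (A N : set R) :
  (@lebesgue_measure R).-negligible N -> Phi_plus (A `|` N) `<=` Phi_plus A.
Proof.
move=> N0; apply: (subset_trans (@Phi_plusU _ _ _)).
by rewrite (Phi_plus_negligible N0) setU0.
Qed.

(** At a density point [E] fills almost all of [ball z r], whose measure is [2 * r]; hence every [c]
    below 2 is allowed. *)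
Lemma ae_density_ge (R : realType) (E : set R) (c : R) :
  measurable (E : set (measurableTypeR R)) -> c < 2 ->
  {ae @lebesgue_measure R, forall z, E z -> exists2 e : R, 0 < e &
    forall r, 0 < r -> r < e ->
      ((c * r)%:E <= @lebesgue_measure R (E `&` ball z r))%E}.
Proof.
move=> mE c2; have := lebesgue_density mE.
apply: filter_app; first exact: (ae_filter_ringOfSetsType (@lebesgue_measure R)).
apply: aeW => /= z Dz Ez; move: Dz.
rewrite indicE mem_set //= => Dz.
have : \forall r \near 0^'+, ((c / 2)%:E <
    lebesgue_measure (E `&` ball z r) * (lebesgue_measure (ball z r))^-1)%E.
  by apply: (Dz _ (@nbhs_open_ereal_gt _ 1 (fun=> c / 2) _)); lra.
move=> [e /= e0 eD]; exists e => // r r0 re.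
have /eD/(_ r0) : `|0 - r| < e by rewrite sub0r normrN gtr0_norm.
rewrite lebesgue_measure_ball ?(ltW r0) // inver.
rewrite mulrn_eq0 /= gt_eqF // lte_pdivlMr; last by rewrite pmulrn_lgt0.
rewrite -EFinM => /ltW; congr (_ <= _)%E; congr (_%:E).
by rewrite -mulr_natl; field.
Qed.

Lemma Phi_plus_ae (R : realType) (E : set R) :
  measurable (E : set (measurableTypeR R)) ->
  (@lebesgue_measure R).-negligible (E `\` Phi_plus E).
Proof.
move=> mE; have := ae_density_ge mE (ltr1n R 2).
apply: negligibleS => z /= [Ez nz] H; apply: nz; apply/Phi_plusP.
have [e e0 De] := H Ez; exists 1 => // d d0.
exists (Num.min (e / 2) (d / 2)); split.
- by rewrite lt_min !divr_gt0.
- by rewrite gt_min [X in _ || X]ltr_pdivrMr // ltr_pMr // ltr1n orbT.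
- apply: De; first by rewrite lt_min !divr_gt0.
  by rewrite gt_min ltr_pdivrMr // ltr_pMr // ltr1n.
Qed.

(** * Halving sets in measure *)

(** The measure of the part of [M] up to [t] is a 1-Lipschitz function of [t] running from 0 to the
    measure of [M], so the intermediate value theorem yields the cut. Identities with a factor 2 are
    ready for summation over cells. *)
Lemma halve_measure (R : realType) (M : set R) (a b : R) : a <= b ->
  measurable (M : set (measurableTypeR R)) -> M `<=` `]a, b] ->
  exists H : set R, [/\ measurable (H : set (measurableTypeR R)), H `<=` M,
    @lebesgue_measure R M = (2%:E * lebesgue_measure H)%E &
    @lebesgue_measure R M = (2%:E * lebesgue_measure (M `\` H))%E].
Proof.
move=> ab mM Mab; set mu := @lebesgue_measure R.
have muM : (mu M < +oo)%E.
  apply: (le_lt_trans (le_lebesgue_measure Mab)).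
  by rewrite lebesgue_measure_itv /=; case: ifP => _; rewrite ltry.
have fM (A : set R) : A `<=` M -> mu A \is a fin_num.
  move=> AM; rewrite ge0_fin_numE ?measure_ge0 //.
  by apply: le_lt_trans muM; exact: le_lebesgue_measure.
pose L t := M `&` `]-oo, t]%classic.
have mL t : measurable (L t : set (measurableTypeR R)) by exact: measurableI.
have LM t : L t `<=` M by exact: subIsetl.
pose f t := fine (mu (L t)).
have fL t : mu (L t) = (f t)%:E by rewrite fineK // fM.
have f_lip s t : s <= t -> f s <= f t <= f s + (t - s).
  move=> st; rewrite -!lee_fin EFinD -!fL; apply/andP; split.
    apply: le_lebesgue_measure => x [Mx /=]; rewrite in_itv /= => xs.
    by split=> //=; rewrite in_itv /= (le_trans xs).
  have LU : L t `<=` L s `|` `]s, t]%classic.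
    move=> x [Mx /=]; rewrite in_itv /= => xt; have [xs|sx] := leP x s.
      by left; split.
    by right; rewrite /= in_itv /= sx.
  apply: (le_trans (le_lebesgue_measure LU)).
  apply: (le_trans (lebesgue_measureU_le _ _)); apply: leeD => //.
  rewrite lebesgue_measure_itv /= lte_fin; case: ifP => _.
    by rewrite EFinB.
  by rewrite lee_fin subr_ge0.
have f_cont : {within `[a, b], continuous f}.
  apply: continuous_subspaceT => x; apply/cvgrPdist_le => /= e e0.
  near=> y.
  have xy : `|x - y| <= e by near: y; exact: cvgr_dist_le.
  apply: le_trans xy; have [xy|/ltW yx] := leP x y.
    have /andP[? ?] := f_lip _ _ xy.
    by rewrite !ler0_norm ?subr_le0 // !opprB; lra.
  have /andP[? ?] := f_lip _ _ yx.
  by rewrite !ger0_norm ?subr_ge0 //; lra.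
have fa : f a = 0.
  have La0 : L a = set0.
    rewrite -subset0 => x [/Mab /=].
    by rewrite !in_itv /= => /andP[ax _]; rewrite leNgt ax.
  by rewrite /f La0 /mu measure0.
have fb : mu M = (f b)%:E.
  rewrite -fL; congr (mu _); apply/seteqP; split=> // x Mx; split=> //.
  by have /= := Mab _ Mx; rewrite !in_itv /= => /andP[].
have fb0 : 0 <= f b by rewrite -lee_fin -fb measure_ge0.
have [|c _ fc] := @IVT R f a b (f b / 2) ab f_cont.
  by rewrite fa ge_min le_max; apply/andP; split; apply/orP; [left|right]; lra.
exists (L c); split=> //.
  by rewrite fL fb fc -EFinM; congr (_%:E); field.
have -> : mu (M `\` L c) = (mu M - mu (L c))%E.
  by rewrite /mu measureD // setIidr.
rewrite fL fb fc -EFinB -EFinM; congr (_%:E); field.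
Unshelve. all: by end_near. Qed.

(** In the last clause [J] absorbs every cell meeting [I]: these cells cover the part of the union
    in [I], and their halves lie in [J]. *)
Lemma halve_cells (R : realType) (M : nat -> set R) (a b : nat -> R) :
  (forall i, measurable (M i : set (measurableTypeR R))) ->
  (forall i, a i <= b i) -> (forall i, M i `<=` `]a i, b i]) ->
  exists S1 S2 : set R,
  [/\ measurable (S1 : set (measurableTypeR R)) /\
      measurable (S2 : set (measurableTypeR R)),
      S1 `|` S2 `<=` \bigcup_i M i, S1 `&` S2 = set0 &
      forall I J : set R, (forall i, M i `&` I !=set0 -> M i `<=` J) ->
      (@lebesgue_measure R (\bigcup_i M i `&` I) <=
         2%:E * lebesgue_measure (S1 `&` J))%E /\
      (@lebesgue_measure R (\bigcup_i M i `&` I) <=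
         2%:E * lebesgue_measure (S2 `&` J))%E].
Proof.
move=> mM ab Mab; set mu := @lebesgue_measure R.
pose D := seqDU M.
have DM i : D i `<=` M i by exact: subset_seqDU.
have mD i : measurable (D i : set (measurableTypeR R)).
  exact: seqDU_measurable.
have tD : trivIset setT D by exact: trivIset_seqDU.
have UD : \bigcup_i M i = \bigcup_i D i by exact: seqDU_bigcup_eq.
have hD i := halve_measure (ab i) (mD i) (subset_trans (DM i) (Mab i)).
pose H i := sval (cid (hD i)).
have HP i : [/\ measurable (H i : set (measurableTypeR R)), H i `<=` D i,
    mu (D i) = (2%:E * mu (H i))%E & mu (D i) = (2%:E * mu (D i `\` H i))%E].
  exact: svalP (cid (hD i)).
have tS (F : nat -> set R) : (forall i, F i `<=` D i) -> trivIset setT F.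
  move=> FD i j _ _ [x [Fi Fj]]; apply: (tD i j I I).
  by exists x; split; exact: FD.
have half (F : nat -> set R) (I J : set R) :
    (forall i, measurable (F i : set (measurableTypeR R))) ->
    (forall i, F i `<=` D i) -> (forall i, mu (D i) = (2%:E * mu (F i))%E) ->
    (forall i, M i `&` I !=set0 -> M i `<=` J) ->
    (mu (\bigcup_i M i `&` I) <= 2%:E * mu (\bigcup_i F i `&` J))%E.
  move=> mF FD DF MJ; pose K := [set i | M i `&` I !=set0].
  have sub1 : \bigcup_i M i `&` I `<=` \bigcup_(i in K) D i.
    rewrite UD => x [[i _ Dx] Ix]; exists i => //.
    by exists x; split=> //; exact: DM.
  have sub2 : \bigcup_(i in K) F i `<=` \bigcup_i F i `&` J.
    move=> x [i Ki Fx]; split; first by exists i.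
    by apply: (MJ _ Ki); apply: DM; exact: FD.
  apply: (le_trans (le_lebesgue_measure sub1)).
  (* Both unions are disjoint, so the cellwise identities [DF] add up. *)
  apply: (@le_trans _ _ (2%:E * mu (\bigcup_(i in K) F i))%E).
    have tK (F' : nat -> set R) : trivIset setT F' -> trivIset K F'.
      exact: sub_trivIset.
    rewrite /mu measure_bigcup //; last exact/tK.
    rewrite measure_bigcup //; last exact/tK/tS.
    by rewrite -nneseriesZl // (eq_eseriesr (fun i _ => DF i)) //.
  by rewrite lee_pmul2l //; exact: le_lebesgue_measure.
exists (\bigcup_i H i), (\bigcup_i (D i `\` H i)); split.
- split; apply: bigcupT_measurable => i; first by case: (HP i).
  by apply: measurableD => //; case: (HP i).
- rewrite UD => x [[i _ Hx]|[i _ [Dx _]]]; exists i => //.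
  by case: (HP i) => _ HD _ _; exact: HD.
- rewrite -subset0 => x [[i _ Hx] [j _ [Dx nHx]]].
  have Dix : D i x by case: (HP i) => _ HD _ _; exact: HD.
  have ij : i = j by apply: (tD i j I I); exists x.
  by apply: nHx; rewrite -ij.
- move=> I J MJ; split; apply: half => // i.
  + by case: (HP i).
  + by case: (HP i).
  + by case: (HP i).
  + by apply: measurableD => //; case: (HP i).
  + by case: (HP i).
Qed.

(** * Shrinking open sets and cells *)

Lemma negligible_nested_opens (R : realType) (N : set R) :
  (@lebesgue_measure R).-negligible N ->
  exists G : nat -> set R, [/\ forall k, open (G k),
    forall j k, (j <= k)%N -> G k `<=` G j, forall k, N `<=` G k &
    forall k, (@lebesgue_measure R (G k) <= (k.+1%:R^-1)%:E)%E].
Proof.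
move=> /negligible_outer_measure N0.
have Uex k : exists U : set R, [/\ open U, N `<=` U &
    (@lebesgue_measure R U <= (k.+1%:R^-1)%:E)%E].
  have k0 : 0 < k.+1%:R^-1 :> R by rewrite invr_gt0.
  have [U [oU NU Uk]] := outer_measure_open_le N k0.
  by exists U; split=> //; move: Uk; rewrite N0 add0e.
pose U k := sval (cid (Uex k)).
have UP k : [/\ open (U k), N `<=` U k &
    (@lebesgue_measure R (U k) <= (k.+1%:R^-1)%:E)%E] by exact: svalP (cid (Uex k)).
(* Finite intersections make the sets decrease; the range includes [k] itself, which keeps the
   measure bound of [U k]. *)
exists (fun k => \bigcap_(i < k.+1) U i); split.
- move=> k; rewrite bigcap_mkord; elim/big_ind: _ => //.
  + exact: openT.
  + exact: openI.
  + by move=> i _; case: (UP i).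
- by move=> j k jk x Gx i /= ij; apply: Gx; rewrite /= (leq_trans ij).
- by move=> k x Nx i _; case: (UP i) => _ NU _; exact: NU.
- move=> k; case: (UP k) => _ _; apply: le_trans.
  by apply: le_lebesgue_measure => x; apply; rewrite /=.
Qed.

(** Any element of [P] above half of its supremum will do. *)
Lemma bounded_doubling_free (R : realType) (P : R -> Prop) (b h0 : R) :
  P h0 -> (forall h, P h -> 0 < h <= b) ->
  exists2 h, P h & forall h', P h' -> h' < 2 * h.
Proof.
move=> Ph0 Pb; have supP : has_sup [set h | P h].
  by split; [exists h0 | exists b => h /Pb /andP[]].
have s0 : 0 < sup [set h | P h].
  have /andP[h00 _] := Pb _ Ph0; apply: (lt_le_trans h00).
  exact: (ub_le_sup supP.2 Ph0).
have [||h Ph sh] := @sup_gt R [set h | P h] (sup [set h | P h] / 2).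
- by exists h0.
- lra.
exists h => // h' Ph'; have := ub_le_sup supP.2 Ph'; lra.
Qed.

(** The ball has measure twice its radius, so the bound says density at least 1/2. The factor 5
    makes room for balls of three times the radius around points within two radii of the centre.
    Rational centres and radii [n.+1%:R^-1] keep the cells countable in number. *)
Definition cell_ok (R : realType) (E : set R) (G : nat -> set R)
    (j : nat) (q : rat) (n : nat) :=
  ((n.+1%:R^-1)%:E <= @lebesgue_measure R (E `&` ball (ratr q : R) n.+1%:R^-1))%E /\
  ball (ratr q : R) (5 * n.+1%:R^-1) `<=` G j.

(** For decreasing [G], removing [G j.+1] forces [k <= j] as soon as the cell meets [G k]. *)
Definition cell (R : realType) (E : set R) (G : nat -> set R)
    (t : nat * rat * nat) : set R :=
  let: (j, q, n) := t in
  [set x | [/\ cell_ok E G j q n, E x, ball (ratr q : R) n.+1%:R^-1 x & ~ G j.+1 x]].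

Lemma measurable_cell (R : realType) (E : set R) (G : nat -> set R) t :
  measurable (E : set (measurableTypeR R)) -> (forall k, open (G k)) ->
  measurable (cell E G t : set (measurableTypeR R)).
Proof.
move=> mE oG; case: t => [[j q] n]; rewrite /cell.
have [ok|nok] := pselect (cell_ok E G j q n); last first.
  rewrite (_ : [set _ | _] = set0) // -subset0.
  by move=> x [ok]; case: nok.
rewrite (_ : [set _ | _] =
    (E `&` ball (ratr q : R) n.+1%:R^-1 : set R) `\` G j.+1); last first.
  by apply/seteqP; split=> [x [_ ? ? ?]|x [[? ?] ?]].
apply: measurableD; last exact: open_measurable.
by apply: measurableI => //; exact: measurable_ball.
Qed.

(** Outside the null intersection of the [G k], each point of [G 0] lies in some [G j] but not in
    [G j.+1]; if [E] has density 1 there, a small ball with a nearby rational centre is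
    admissible. *)
Lemma cells_cover (R : realType) (E : set R) (G : nat -> set R) :
  measurable (E : set (measurableTypeR R)) -> (forall k, open (G k)) ->
  (forall k, (@lebesgue_measure R (G k) <= (k.+1%:R^-1)%:E)%E) ->
  (@lebesgue_measure R).-negligible ((E `&` G 0%N) `\` \bigcup_t cell E G t).
Proof.
move=> mE oG muG.
have G0 : (@lebesgue_measure R).-negligible (\bigcap_k G k).
  apply/negligibleP.
    by apply: bigcapT_measurable => k; exact: open_measurable.
  apply/eqP; rewrite eq_le measure_ge0 andbT; apply/lee_addgt0Pr => _/posnumP[e].
  rewrite add0e; have [k] : exists k : nat, k.+1%:R^-1 < e%:num.
    have [k _ Hk] := near_infty_natSinv_lt e; exists k; exact: Hk k (leqnn k).
  move=> /ltW ke; apply: (@le_trans _ _ (k.+1%:R^-1)%:E); last by rewrite lee_fin.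
  by apply: le_trans (muG k); apply: le_lebesgue_measure; exact: bigcap_inf.
(* With [4 / 3], the ball of radius [3 / 4 * s] around [x] already holds measure [s] of [E], and it
   fits in the ball of radius [s] around any [q] closer than [s / 4]. *)
have c43 : 4 / 3 < 2 :> R by lra.
have := ae_density_ge mE c43; move=> De.
apply: negligibleS (negligibleU De G0) => x [[Ex G0x] nx].
have [|nG] := pselect ((\bigcap_k G k) x); [by right|left => /= Dx; apply: nx].
have [j Gjx nGjx] : exists2 j, G j x & ~ G j.+1 x.
  apply: contrapT => H; apply: nG => k _; elim: k => // k IH.
  by apply: contrapT => nGk; apply: H; exists k.
have [e e0 {}Dx] := Dx Ex.
have [r /= r0 rG] := oG j x Gjx.
(* With [s < r / 6], the dilated ball stays within [5 * s + s / 4 < r] of [x]. *)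
have d0 : 0 < Num.min e (r / 6) by rewrite lt_min e0; lra.
have [n nd] : exists n : nat, n.+1%:R^-1 < Num.min e (r / 6).
  have [n _ Hn] := near_infty_natSinv_lt (PosNum d0); exists n; exact: Hn n (leqnn n).
move: nd; set s : R := n.+1%:R^-1; rewrite lt_min => /andP[se sr].
have s0 : 0 < s by rewrite invr_gt0.
have [|q] := @rat_in_itvoo R (x - s / 4) (x + s / 4); first by lra.
rewrite in_itv /= => /andP[q1 q2].
exists (j, q, n) => //; split=> //; last first.
  by rewrite /ball /= ltr_norml -/s; apply/andP; split; lra.
split.
- rewrite -/s; have s34 : 0 < 3 / 4 * s by lra.
  have := Dx _ s34; rewrite (_ : 4 / 3 * (3 / 4 * s) = s); last by field.
  move=> /(_ _)/le_trans; apply; first by lra.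
  apply: le_lebesgue_measure; apply: setIS => y; rewrite /ball /= !ltr_norml.
  by move=> /andP[? ?]; apply/andP; split; lra.
- move=> y; rewrite -/s /ball /= ltr_norml => /andP[? ?]; apply: rG.
  by rewrite /ball /= ltr_norml; apply/andP; split; lra.
Qed.

(** If the cell had radius [s >= h], its centre would be within [2 * s] of [x], so [ball x (3 * s)]
    would contain the ball of the cell and lie in its fivefold dilation. As [c * (3 * s) <= s],
    [3 * s < 2 * h] would follow, which is absurd. So [s < h], and the cell stays within [h + 2 * s]
    of [x]. *)
Lemma cells_meeting_maximal_ball (R : realType) (E : set R) (G : nat -> set R)
    (k : nat) (t : nat * rat * nat) (x c h : R) :
  (forall i j, (i <= j)%N -> G j `<=` G i) -> c <= 1 / 6 ->
  ball x h `<=` G k ->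
  (forall h', 0 < h' -> ball x h' `<=` G k ->
     ((c * h')%:E <= @lebesgue_measure R (E `&` ball x h'))%E -> h' < 2 * h) ->
  cell E G t `&` ball x h !=set0 -> cell E G t `<=` ball x (3 * h).
Proof.
move=> Gle c6 hG hmax; case: t => [[j q] n] [z [[[Eq qG] _ qz nGz] xz]].
move: Eq qG qz; set s : R := n.+1%:R^-1 => Eq qG qz.
have s0 : 0 < s by rewrite invr_gt0.
have kj : (k <= j)%N.
  by rewrite leqNgt; apply/negP => jk; apply: nGz; apply: (Gle _ _ jk); exact: hG.
move: qz xz; rewrite /ball /= !ltr_norml => /andP[? ?] /andP[? ?].
have sh : s < h.
  rewrite ltNge; apply/negP => hs; suff : 3 * s < 2 * h by lra.
  apply: hmax; first by lra.
    apply: subset_trans (Gle _ _ kj); apply: subset_trans qG => y.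
    by rewrite /ball /= !ltr_norml => /andP[? ?]; apply/andP; split; lra.
  apply: (@le_trans _ _ s%:E).
    have : c * (3 * s) <= 1 / 6 * (3 * s) by rewrite ler_wpM2r //; lra.
    by rewrite lee_fin; lra.
  apply: (le_trans Eq); apply: le_lebesgue_measure; apply: setIS => y.
  by rewrite /ball /= !ltr_norml => /andP[? ?]; apply/andP; split; lra.
move=> y [_ _]; rewrite -/s /ball /= !ltr_norml => /andP[? ?] _.
by apply/andP; split; lra.
Qed.

(** * Splitting a set while keeping positive upper density on a null set *)

Lemma split_Phi_plus (R : realType) (E N : set R) :
  measurable (E : set (measurableTypeR R)) ->
  (@lebesgue_measure R).-negligible N -> N `<=` Phi_plus E ->
  exists S1 S2 : set R,
  [/\ measurable (S1 : set (measurableTypeR R)) /\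
      measurable (S2 : set (measurableTypeR R)),
      S1 `|` S2 `<=` E, S1 `&` S2 = set0,
      N `<=` Phi_plus S1 & N `<=` Phi_plus S2].
Proof.
move=> mE N0 NE; set mu := @lebesgue_measure R.
have [G [oG Gle NG muG]] := negligible_nested_opens N0.
(* Codes that decode to no triple get the empty cell, with centre and radius 0. *)
pose M i := if unpickle i is Some t then cell E G t else set0.
pose ctr i : R :=
  if @unpickle (nat * rat * nat)%type i is Some t then ratr t.1.2 else 0.
pose rad i : R :=
  if @unpickle (nat * rat * nat)%type i is Some t then t.2.+1%:R^-1 else 0.
have mM i : measurable (M i : set (measurableTypeR R)).
  by rewrite /M; case: unpickle => [t|//]; exact: measurable_cell.
have ab i : ctr i - rad i <= ctr i + rad i.
  have : 0 <= rad i by rewrite /rad; case: unpickle => // t; rewrite invr_ge0.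
  lra.
have Mab i : M i `<=` `]ctr i - rad i, ctr i + rad i].
  rewrite /M /ctr /rad; case: unpickle => [[[j q] n]|//] x [_ _].
  rewrite /ball /= ltr_norml in_itv /=; set s := n.+1%:R^-1.
  by move=> /andP[? ?] _; apply/andP; split; lra.
have UM : \bigcup_i M i = \bigcup_t cell E G t.
  apply/seteqP; split=> x [i _].
    by rewrite /M; case: unpickle => [t|//]; exists t.
  by move=> Ex; exists (pickle i) => //; rewrite /M pickleK.
have [S1 [S2 [mS SM S12 half]]] := halve_cells mM ab Mab.
have key x : N x -> exists2 c : R, 0 < c & forall e, 0 < e -> exists h : R,
    [/\ 0 < h, h < e, ((c * h)%:E <= mu (S1 `&` ball x h))%E &
      ((c * h)%:E <= mu (S2 `&` ball x h))%E].
  move=> Nx; have [c0 c00 Ec0] := (Phi_plusP E x).1 (NE _ Nx).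
  pose c := Num.min c0 (1 / 6).
  have c_gt0 : 0 < c by rewrite lt_min c00; lra.
  have c6 : c <= 1 / 6 by rewrite ge_min lexx orbT.
  (* A factor 2 is lost by halving and a factor 3 by passing from [ball x h] to [ball x (3 * h)]. *)
  exists (c / 6); first by lra.
  move=> e e0; have e6 : 0 < e / 6 by lra.
  (* A ball inside [G k] has radius at most [k.+1%:R^-1], hence below [e / 6]; this keeps [3 * h]
     below [e]. *)
  have [k ke] : exists k : nat, k.+1%:R^-1 < e / 6.
    have [k _ Hk] := near_infty_natSinv_lt (PosNum e6).
    by exists k; exact: Hk k (leqnn k).
  pose P h := [/\ 0 < h, ball x h `<=` G k &
    ((c * h)%:E <= mu (E `&` ball x h))%E].
  have [r /= r0 rG] := oG k x (NG k _ Nx).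
  have [h0 [h00 h0r ch0]] := Ec0 r r0.
  have Ph0 : P h0.
    split=> //.
      move=> y; rewrite /ball /= => xy; apply: rG; exact: lt_trans xy h0r.
    by apply: le_trans ch0; rewrite lee_fin ler_pM2r // ge_min lexx.
  have h_le h : 0 < h -> ball x h `<=` G k -> h <= k.+1%:R^-1.
    move=> h_gt0 hG; have := le_trans (le_lebesgue_measure hG) (muG k).
    rewrite lebesgue_measure_ball ?(ltW h_gt0) // lee_fin.
    by apply: le_trans; rewrite mulr2n lerDl ltW.
  have [|h [h_gt0 hG ch] hmax] := @bounded_doubling_free R P (k.+1%:R^-1) h0 Ph0.
    by move=> h [h_gt0 hG _]; rewrite h_gt0 h_le.
  have he : h < e / 6 by exact: le_lt_trans (h_le h h_gt0 hG) ke.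
  have [|half1 half2] := half (ball x h) (ball x (3 * h)).
    move=> i; rewrite /M; case: unpickle => [t|[z []//]].
    apply: (cells_meeting_maximal_ball Gle c6 hG) => h' h'0 h'G ch'.
    exact: hmax.
  (* The ball lies in [G 0], where the cells miss only a null part of [E]. *)
  have Ecov : (mu (E `&` ball x h) <= mu (\bigcup_i M i `&` ball x h))%E.
    have sub : E `&` ball x h `<=` (\bigcup_i M i `&` ball x h) `|`
        ((E `&` G 0%N) `\` \bigcup_t cell E G t).
      rewrite -UM => y [Ey xy].
      have [My|nMy] := pselect ((\bigcup_i M i) y); [by left|right].
      by do !split=> //; apply: (Gle 0%N k) => //; exact: hG.
    apply: (le_trans (le_lebesgue_measure sub)).
    apply: (le_trans (lebesgue_measureU_le _ _)).
    rewrite (lebesgue_measure_negligible (cells_cover mE oG muG)).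
    by rewrite adde0.
  have conclude (S : set R) :
      (mu (\bigcup_i M i `&` ball x h) <= 2%:E * mu (S `&` ball x (3 * h)))%E ->
      ((c / 6 * (3 * h))%:E <= mu (S `&` ball x (3 * h)))%E.
    move=> HS; have := le_trans (le_trans ch Ecov) HS.
    rewrite (_ : c * h = 2 * (c / 6 * (3 * h))); last by field.
    by rewrite EFinM lee_pmul2l.
  exists (3 * h); split; [lra | lra | exact: conclude | exact: conclude].
have sub_Phi (S : set R) : (forall x, N x -> exists2 c : R, 0 < c &
    forall e, 0 < e -> exists h : R,
    [/\ 0 < h, h < e & ((c * h)%:E <= mu (S `&` ball x h))%E]) ->
    N `<=` Phi_plus S.
  by move=> HS x /HS ?; apply/Phi_plusP.
exists S1, S2; split; [exact: mS | | exact: S12 | |].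
- by apply: (subset_trans SM); rewrite UM => x [[[j q] n] _ [_ Ex _ _]].
- apply: sub_Phi => x /key[c c0 cP]; exists c => // e /cP[h [? ? ? _]].
  by exists h.
- apply: sub_Phi => x /key[c c0 cP]; exists c => // e /cP[h [? ? _ ?]].
  by exists h.
Qed.

(** * From Borel to Lebesgue measurable sets *)

(** The Caratheodory sigma-algebra is the completion of the Borel one. *)
Lemma lebesgue_measurableP (R : realType) (A : set R) :
  lebesgue_measurable A <->
  exists B N : set R, [/\ measurable (B : set (measurableTypeR R)),
    (@lebesgue_measure R).-negligible N & A = B `|` N].
Proof.
rewrite /lebesgue_measurable -completed_caratheodory_measurable.
rewrite g_sigma_completed_algebra_genE; split.
  by move=> [B mB [N N0 <-]]; exists B, N.
by move=> [B [N [mB N0 ->]]]; exists B => //; exists N.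
Qed.

Lemma lebesgue_measurable_negligible (R : realType) (N : set R) :
  (@lebesgue_measure R).-negligible N -> lebesgue_measurable N.
Proof.
move=> N0; apply/lebesgue_measurableP; exists set0, N; split=> //.
by rewrite set0U.
Qed.

Lemma Phi_plus_ae_lebesgue (R : realType) (A : set R) :
  lebesgue_measurable A -> (@lebesgue_measure R).-negligible (A `\` Phi_plus A).
Proof.
move=> /lebesgue_measurableP[B [N [mB N0 ->]]].
apply: negligibleS (negligibleU (Phi_plus_ae mB) N0) => x [[Bx|Nx] nx]; last by right.
left; split; first exact: Bx.
by move: nx; apply: contra_not; apply: Phi_plusS; exact: subsetUl.
Qed.

(** Only a null set is removed from [A], so positive upper densities stay positive. *)
Lemma T_plus_setI_Phi_plus (R : realType) (A : set R) :
  lebesgue_measurable A -> T_plus R (A `&` Phi_plus A).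
Proof.
move=> mA; have N0 := Phi_plus_ae_lebesgue mA; split.
  rewrite (_ : A `&` _ = A `\` (A `\` Phi_plus A)); last by rewrite setDD.
  apply: measurableD => //; exact: lebesgue_measurable_negligible.
have sub : A `<=` (A `&` Phi_plus A) `|` (A `\` Phi_plus A) by rewrite setUIDK.
by move=> x [_ /(Phi_plusS sub)]; exact: (Phi_plusU_negligible N0).
Qed.

(** * Separation of disjoint closed sets *)

Theorem theorem18 (R : realType) : gt_normal (T_plus R).
Proof.
move=> A B [mAC AC] [mBC BC] AB0.
have mA : lebesgue_measurable A by rewrite -(setCK A); exact: measurableC.
have mB : lebesgue_measurable B by rewrite -(setCK B); exact: measurableC.
have mE : lebesgue_measurable (~` (A `|` B)).
  by apply: measurableC; exact: measurableU.
have [E [Z [mE' Z0 EZ]]] := (lebesgue_measurableP _).1 mE.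
pose N := (A `\` Phi_plus A) `|` (B `\` Phi_plus B).
have N0 : (@lebesgue_measure R).-negligible N.
  by apply: negligibleU; exact: Phi_plus_ae_lebesgue.
(* Here [X] will be one of the closed sets and [Y] the complement of the other. A point of [X] lies
   in [Y], hence in [Phi_plus Y]; if it is not in [Phi_plus X], it is in [Phi_plus E]. *)
have dichotomy (X Y : set R) : Y `<=` X `|` (E `|` Z) ->
    Phi_plus Y `<=` Phi_plus X `|` Phi_plus E.
  move=> YX x /(Phi_plusS YX) /Phi_plusU[|/(Phi_plusU_negligible Z0)].
    by left.
  by right.
have ABx x : A x -> B x -> False by move=> Ax Bx; rewrite -[False]/(set0 x) -AB0.
have NE : N `<=` Phi_plus E.
  move=> x [[Ax nx]|[Bx nx]].
    have /BC : (~` B) x by move=> Bx; exact: (ABx x).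
    case/(dichotomy A) => [y nBy|/nx[]|//]; rewrite -EZ.
    by have [Ay|nAy] := pselect (A y); [left|right=> -[]].
  have /AC : (~` A) x by move=> Ax; exact: (ABx x).
  case/(dichotomy B) => [y nAy|/nx[]|//]; rewrite -EZ.
  by have [By|nBy] := pselect (B y); [left|right=> -[]].
have [S1 [S2 [[mS1 mS2] SE S12 NS1 NS2]]] := split_Phi_plus mE' N0 NE.
have mU (X S : set R) : lebesgue_measurable X ->
    measurable (S : set (measurableTypeR R)) -> lebesgue_measurable (X `|` S).
  move=> mX mS; apply: measurableU => //; apply/lebesgue_measurableP.
  by exists S, set0; split; [|exact: negligible_set0|rewrite setU0].
(* Where [X] has upper density 0 at its own points, [S] makes up for it, so cutting with [Phi_plus]
   loses no point of [X]. *)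
have subU (X S : set R) : X `\` Phi_plus X `<=` Phi_plus S ->
    X `<=` (X `|` S) `&` Phi_plus (X `|` S).
  move=> XS x Xx; split; first by left.
  have [Px|nPx] := pselect (Phi_plus X x).
    by apply: Phi_plusS Px; exact: subsetUl.
  by apply: (Phi_plusS (@subsetUr _ X S)); exact: XS.
have SAB x : (S1 `|` S2) x -> ~ A x /\ ~ B x.
  move=> Sx; have : (~` (A `|` B)) x by rewrite EZ; left; exact: SE.
  by move=> nAB; split=> ?; apply: nAB; [left|right].
exists ((A `|` S1) `&` Phi_plus (A `|` S1)), ((B `|` S2) `&` Phi_plus (B `|` S2)).
split.
- by apply: T_plus_setI_Phi_plus; exact: mU.
- by apply: T_plus_setI_Phi_plus; exact: mU.
- by apply: subU => x ?; apply: NS1; left.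
- by apply: subU => x ?; apply: NS2; right.
- rewrite -subset0 => x [[[Ax|S1x] _] [[Bx|S2x] _]].
  + exact: (ABx x).
  + by have [nA _] := SAB x (or_intror S2x).
  + by have [_ nB] := SAB x (or_introl S1x).
  + by rewrite -S12.
Qed.
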